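(* For any integers $k\ge 1$ and $l\ge 2$, as $n\to\infty$, $$ex(n,C_{2l},C_{2k+1})=(1+o(1))\frac{1}{2l}\left(\frac{n^2}{4}\right)^l.$$
   Context: $C_k$ denotes the cycle with $k$ vertices. $ex(n,H,F)$ is the maximum number of subgraphs isomorphic to $H$ in an $n$-vertex graph containing no subgraph isomorphic to $F$. *)

(* Defs.v *)
From HB Require Import structures.
From mathcomp Require Import all_boot all_order all_algebra.
From mathcomp Require Import all_classical all_reals all_analysis.
Set Implicit Arguments. Unset Strict Implicit. Unset Printing Implicit Defensive.

Definition simple_graph (n : nat) (E : {set {set 'I_n}}) : bool :=
  [forall e in E, #|e| == 2].

(* S is the edge set of a cycle of length m on 'I_n (i.e. a subgraph isomorphic
   to C_m; for m >= 3 such a subgraph is determined by its edge set): there is an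
   injective map f : 'I_m -> 'I_n with S = { {f i, f (i+1 mod m)} : i < m }. *)
Definition is_cycle_edges (m n : nat) (S : {set {set 'I_n}}) : bool :=
  [exists f : {ffun 'I_m -> 'I_n},
     injectiveb f && (S == [set [set f i; f (ordS i)] | i : 'I_m])].

Definition num_cycles (m n : nat) (E : {set {set 'I_n}}) : nat :=
  #|[set S : {set {set 'I_n}} | (S \subset E) && is_cycle_edges m S]|.

Definition cycle_free (m n : nat) (E : {set {set 'I_n}}) : bool :=
  [forall S : {set {set 'I_n}}, (S \subset E) ==> ~~ is_cycle_edges m S].

Definition ex_cycles (n h f : nat) : nat :=
  \max_(E : {set {set 'I_n}} | simple_graph E && cycle_free f E) num_cycles h E.

(* Main.v *)
(* Lower bound: the bipartite graph joining even to odd vertices.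

   Upper bound: in a C_{2k+1}-free graph G the neighbourhood of a vertex y
   contains no path on 2k vertices, so it spans O(n) edges.  The number of walks
   of length 2 from y is the number of edges meeting N(y), counted twice when
   they lie inside N(y), so it is at most e(G) + O(n).  Summing over y and using
   Cauchy-Schwarz on the degrees gives e(G) <= n^2/4 + O(n), so every vertex
   starts at most n^2/4 + O(n) walks of length 2, and G has at most
   2 (n^2/4 + O(n))^l walks on 2l vertices.  Each C_{2l} yields 4l of them. *)
Require Import Defs.
From HB Require Import structures.
From mathcomp Require Import all_boot all_order all_algebra.
From mathcomp Require Import all_classical all_reals all_analysis.
From mathcomp Require Import zify ring fintype finset.
Set Implicit Arguments. Unset Strict Implicit. Unset Printing Implicit Defensive.
Import Order.TTheory GRing.Theory Num.Theory.
Import numFieldNormedType.Exports.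

(** * Counting walks in a graph *)

Section Walks.
Variables (T : finType) (e : rel T).

(** The start [x] is left out of the listed sequences, to match [path e x p]. *)
Fixpoint walks (j : nat) (x : T) : seq (seq T) :=
  if j is j'.+1 then [seq y :: p | y <- enum (e x), p <- walks j' y]
  else [:: [::]].

Lemma mem_walks j x p : (p \in walks j x) = (size p == j) && path e x p.
Proof.
elim: j x p => [|j IHj] x [|y p]; rewrite /= ?inE //.
  by apply/negbTE/negP => /allpairsPdep[? [? []]].
rewrite eqSS; apply/allpairsPdep/and3P => [[z [q [ez hq [-> ->]]]]|[sp exy pp]].
  by move: hq ez; rewrite IHj mem_enum => /andP[-> ->].
by exists y, p; rewrite mem_enum IHj sp pp.
Qed.

Lemma size_walksS j x :
  size (walks j.+1 x) = \sum_(y | e x y) size (walks j y).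
Proof. by rewrite /= size_allpairs_dep sumnE big_map big_enum. Qed.

Lemma size_walks1 x : size (walks 1 x) = \sum_(y | e x y) 1.
Proof. by rewrite size_walksS. Qed.

(** Cuts a walk of length [2 * j] into [j] pieces of length 2. The factor [c] stands for the
    denominator of the bound [D / c], so that everything stays in [nat]. *)
Lemma size_walks_even (c D : nat) :
  (forall x, c * size (walks 2 x) <= D) ->
  forall j x, c ^ j * size (walks (2 * j) x) <= D ^ j.
Proof.
move=> hD; elim=> [|j IHj] x //.
have -> : 2 * j.+1 = (2 * j).+2 by lia.
rewrite size_walksS; under eq_bigr do rewrite size_walksS.
apply: (@leq_trans (c * \sum_(y | e x y) \sum_(z | e y z) D ^ j)).
  rewrite expnS -mulnA leq_mul2l; apply/orP; right.
  rewrite big_distrr /=; apply: leq_sum => y _.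
  rewrite big_distrr /=; exact: leq_sum.
have -> : \sum_(y | e x y) \sum_(z | e y z) D ^ j = size (walks 2 x) * D ^ j.
  rewrite size_walksS big_distrl; apply: eq_bigr => y _.
  by rewrite size_walks1 big_distrl; apply: eq_bigr => z _ /=; rewrite mul1n.
by rewrite mulnA expnS leq_mul2r hD orbT.
Qed.

Lemma sum_size_walks1 :
  \sum_x size (walks 1 x) = #|[set u : T * T | e u.1 u.2]|.
Proof.
under eq_bigr do rewrite size_walks1.
rewrite pair_big_dep /= -sum1_card; apply: eq_bigl => u.
by rewrite inE.
Qed.

Hypotheses (symE : symmetric e) (irrE : irreflexive e).

(** Greedy extension at the head: as long as the path has at most [p] vertices, the [p] neighbours
    of its head cannot all lie among the fewer than [p] other vertices. *)
Lemma min_degree_path (p : nat) (A : {set T}) :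
    (forall x, x \in A -> p <= #|[set y in A | e x y]|) -> A != set0 ->
  exists s, [/\ size s = p.+1, uniq s, sorted e s & {subset s <= A}].
Proof.
move=> hp /set0Pn[x0 x0A].
(* Separates the length of the path from the degree bound [p], which stays fixed in [hp] during the
   induction. *)
have [j [Hj ->]] : exists j, j <= p /\ p = j by exists p.
elim: j Hj => [|j IHj] jp.
  by exists [:: x0]; split=> // y; rewrite inE => /eqP->.
have [[|x s] [//]] := IHj (ltnW jp).
move=> [ss] us pth sA.
have xA : x \in A by apply: sA; rewrite inE eqxx.
have [y] : exists y, y \in [set y in A | e x y] :\: [set y in s].
  apply/set0Pn; rewrite setD_eq0; apply/negP => /subset_leq_card.
  rewrite [#|[set y in s]|]cardsE => /(leq_trans (hp _ xA)).
  by move/leq_trans/(_ (card_size s)); rewrite ss leqNgt jp.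
rewrite !inE => /and3P[ys yA exy].
exists (y :: x :: s); split; first by rewrite /= ss.
- rewrite cons_uniq us andbT inE negb_or ys andbT; apply: contraTneq exy => ->.
  by rewrite irrE.
- by rewrite /= symE exy; apply: pth.
- by move=> z; rewrite inE => /orP[/eqP->|/sA].
Qed.

(* A weak form of the Erdos-Gallai bound; edges are counted as ordered pairs. *)
Lemma sparse_or_path (p : nat) (A : {set T}) :
  (exists s, [/\ size s = p.+1, uniq s, sorted e s & {subset s <= A}]) \/
  #|[set u : T * T | [&& e u.1 u.2, u.1 \in A & u.2 \in A]]| <= 2 * p * #|A|.
Proof.
have [m Am] := ubnP #|A|; elim: m A Am => // m IHm A Am.
have [->|A0] := eqVneq A set0.
  right; rewrite cards0 muln0 leqn0 cards_eq0; apply/eqP/setP => u.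
  by rewrite !inE /= andbF.
have [/forall_inP hA|] := boolP [forall x in A, p <= #|[set y in A | e x y]|].
  by left; apply: min_degree_path.
(* A vertex [x] with fewer than [p] neighbours in [A] is deleted: this loses at most [2 * p] ordered
   pairs, and induction treats the rest. *)
rewrite negb_forall_in => /exists_inP[x xA]; rewrite -ltnNge => degx.
have cA := cardsD1 x A; rewrite xA add1n in cA.
have /IHm[[s [ss us ps sA]]|hle] : #|A :\ x| < m by lia.
  by left; exists s; split=> // z /sA; rewrite inE => /andP[].
right; set N := [set y in A | e x y] in degx.
set B := [set u | _] in hle.
apply: (@leq_trans #|B :|: ([set (x, y) | y in N] :|: [set (y, x) | y in N])|).
  apply/subset_leq_card/subsetP => -[y z]; rewrite !inE /=.
  case/and3P=> eyz yA zA; rewrite eyz yA zA /= !andbT.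
  have [yx|yx] /= := eqVneq y x.
    by apply/orP; left; apply/imsetP; exists z; rewrite ?inE ?zA -?yx.
  have [zx|zx] //= := eqVneq z x.
  by apply/orP; right; apply/imsetP; exists y; rewrite ?inE ?yA -?zx // symE.
have h1 : #|[set (x, y) | y in N]| <= #|N| := leq_imset_card _ _.
have h2 : #|[set (y, x) | y in N]| <= #|N| := leq_imset_card _ _.
apply: leq_trans (leq_card_setU _ _) _.
rewrite cA mulnS addnC leq_add // mul2n -addnn.
apply: leq_trans (leq_card_setU _ _) _.
by rewrite leq_add // (leq_trans _ (ltnW degx)).
Qed.

(* Inclusion-exclusion on the ordered edges with first, resp. second, end in
   the neighbourhood of [y]. *)
Lemma double_size_walks2 (y : T) :
  2 * size (walks 2 y) <= #|[set u : T * T | e u.1 u.2]| +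
    #|[set u : T * T | [&& e u.1 u.2, e y u.1 & e y u.2]]|.
Proof.
pose X := [set u : T * T | e u.1 u.2 && e y u.1].
pose X' := [set u : T * T | e u.1 u.2 && e y u.2].
have cX : size (walks 2 y) = #|X|.
  rewrite size_walksS; under eq_bigr do rewrite size_walks1.
  rewrite pair_big_dep /= -sum1_card; apply: eq_bigl => u.
  by rewrite inE andbC.
have cX' : #|X'| = #|X|.
  rewrite -(card_imset X (f := fun u : T * T => (u.2, u.1))); last first.
    by move=> [a b] [c d] [-> ->].
  apply: eq_card => -[a b]; apply/idP/imsetP.
    by rewrite inE /= => /andP[eab eyb]; exists (b, a); rewrite // inE /= symE eab.
  by case=> -[c d]; rewrite !inE /= => /andP[ecd eyc] [-> ->]; rewrite symE ecd.
rewrite cX mul2n -addnn -{2}cX' -cardsUI leq_add //.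
  apply/subset_leq_card/subsetP => u; rewrite !inE.
  by rewrite -andb_orr => /andP[].
apply/subset_leq_card/subsetP => u; rewrite !inE.
by case/andP => /andP[-> ->] /andP[_ ->].
Qed.

(** Walks of length 2 are counted by their middle vertex instead of their start. *)
Lemma sum_size_walks2 :
  \sum_x size (walks 2 x) = \sum_x size (walks 1 x) ^ 2.
Proof.
under eq_bigr do rewrite size_walksS big_mkcond.
rewrite exchange_big; apply: eq_bigr => y _.
rewrite -big_mkcond -mulnn {2}size_walks1 big_distrl.
by apply: eq_big => [z|z _] /=; rewrite ?mul1n // symE.
Qed.

End Walks.

(** Cauchy-Schwarz, by summing [2 * (d x * d y) <= d x ^ 2 + d y ^ 2] over all pairs. *)
Lemma leq_sqr_sum (T : finType) (d : T -> nat) :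
  (\sum_x d x) ^ 2 <= #|T| * \sum_x d x ^ 2.
Proof.
rewrite -(leq_pmul2l (isT : 0 < 2)).
have -> : 2 * (#|T| * \sum_x d x ^ 2) =
          \sum_x \sum_y (d x ^ 2 + d y ^ 2).
  under [RHS]eq_bigr do rewrite big_split sum_nat_const /=.
  rewrite big_split [X in _ = _ + X]sum_nat_const /= -big_distrr /=.
  by rewrite mul2n addnn.
rewrite -mulnn big_distrlr /= big_distrr; apply: leq_sum => x _.
rewrite big_distrr; apply: leq_sum => y _.
exact: (nat_Cauchy (d x) (d y)).
Qed.

(** * Cycles as edge sets versus injective cyclic maps *)

Section CycleMaps.
Variables (m n : nat).

Definition cycle_edges (f : {ffun 'I_m -> 'I_n}) : {set {set 'I_n}} :=
  [set [set f i; f (ordS i)] | i : 'I_m].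

Definition cycle_maps (E : {set {set 'I_n}}) : {set {ffun 'I_m -> 'I_n}} :=
  [set f : {ffun 'I_m -> 'I_n} | injectiveb f && (cycle_edges f \subset E)].

Lemma num_cyclesE E : num_cycles m E = #|cycle_edges @: cycle_maps E|.
Proof.
apply: eq_card => S; rewrite inE; apply/andP/imsetP.
  case=> SE /existsP[f /andP[fi /eqP Sf]]; exists f => //.
  by rewrite inE fi -[cycle_edges f]Sf.
case=> f; rewrite inE => /andP[fi fE] ->; split=> //.
by apply/existsP; exists f; rewrite fi eqxx.
Qed.

Lemma cycle_freeE E : cycle_free m E = (cycle_maps E == set0).
Proof.
apply/forallP/eqP => [h|h S].
  apply/setP => f; rewrite !inE; apply/negP => /andP[fi fE].
  have /implyP/(_ fE)/negP := h (cycle_edges f); apply.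
  by apply/existsP; exists f; rewrite fi eqxx.
apply/implyP => SE; apply/negP => /existsP[f /andP[fi /eqP Sf]].
by have := in_set0 f; rewrite -h inE fi -[cycle_edges f]Sf SE.
Qed.

End CycleMaps.

Lemma ordS_add1 m (i : 'I_m.+2) : ordS i = (i + 1)%R.
Proof. by apply: val_inj;rewrite /= [(1 %% _)%N]modn_small // addn1.  Qed.

Lemma ord_natr_ind m (P : 'I_m.+2 -> Prop) :
  (forall j, P j%:R%R) -> forall i, P i.
Proof. by move=> h i; rewrite -[i]natr_Zp. Qed.

Section CardCycleMaps.
Variables (m n : nat).
Implicit Types f g : {ffun 'I_m.+3 -> 'I_n}.
Local Open Scope ring_scope.

Lemma mem_cycle_edges f i : [set f i; f (i + 1)] \in cycle_edges f.
Proof. by apply/imsetP; exists i; rewrite // ordS_add1. Qed.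

Lemma cycle_edgesP f e :
  reflect (exists i, e = [set f i; f (i + 1)]) (e \in cycle_edges f).
Proof.
by apply: (iffP imsetP) => [[i _ ->]|[i ->]]; exists i; rewrite ?ordS_add1.
Qed.

Lemma ord_double1_neq0 : (1 + 1 : 'I_m.+3) != 0.
Proof. by rewrite -val_eqE. Qed.

Lemma eq_set2 (T : finType) (a b c d : T) :
  [set a; b] = [set c; d] -> a = c /\ b = d \/ a = d /\ b = c.
Proof.
move=> h.
have : c \in [set a; b] by rewrite h set21.
have : d \in [set a; b] by rewrite h set22.
have : a \in [set c; d] by rewrite -h set21.
have : b \in [set c; d] by rewrite -h set22.
rewrite !inE.
by do 4!case/orP=> /eqP ?; subst; auto.
Qed.

(* An injective cyclic map is determined by its edge set together with its
   first two values, since consecutive neighbours are distinct. *)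
Lemma eq_cycle_map f g : injective f -> injective g ->
  cycle_edges f = cycle_edges g -> f 0 = g 0 -> f 1 = g 1 -> f = g.
Proof.
move=> fi gi fg e0 e1; apply/ffunP; apply: ord_natr_ind => j.
suff [] : f j%:R = g j%:R /\ f (j%:R + 1) = g (j%:R + 1) by [].
elim: j => [|j [ej ej1]]; first by rewrite !add0r.
rewrite -natr1; set i : 'I_m.+3 := j%:R in ej ej1 *; split=> //.
have := mem_cycle_edges g (i + 1); rewrite -fg => /cycle_edgesP[r].
(* The edge of [g] leaving [i + 1] is one of the two edges of [f] at that vertex. If it led back to
   [f i = g i], injectivity of [g] would contradict [ir]. *)
have ir : i + 1 + 1 != i by rewrite -addrA addrC -subr_eq0 addrK ord_double1_neq0.
case/eq_set2 => [[er e1r]|[er e1r]].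
  by rewrite e1r; congr (f (_ + 1)); apply: fi; rewrite -er.
have ri : r = i by apply: (addIr 1); apply: fi; rewrite -er.
by move: e1r ir; rewrite ri ej => /gi ->; rewrite eqxx.
Qed.

(** The action of the dihedral group: [u.1] is the new starting point and [u.2] the direction. *)
Definition dihedral f (u : 'I_m.+3 * bool) : {ffun 'I_m.+3 -> 'I_n} :=
  [ffun i => f (if u.2 then u.1 + i else u.1 - i)].

(** The value at 0 reveals the shift, and the value at 1 the direction, since [1] and [-1] differ
    modulo a number that is at least 3. *)
Lemma dihedral_inj f : injective f -> injective (dihedral f).
Proof.
move=> fi [j b] [j' b'] /ffunP h.
have jj : j = j'.
  by have := h 0; rewrite !ffunE /= !addr0 !subr0 !if_same => /fi.
rewrite -jj in h *; have := h 1; rewrite !ffunE /= => /fi.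
have nz := ord_double1_neq0.
case: b b' {h} => [] [] // /addrI h1; move: nz; first by rewrite {1}h1 addNr eqxx.
by rewrite -{1}h1 addNr eqxx.
Qed.

Lemma injective_dihedral f u : injective f -> injective (dihedral f u).
Proof.
case: u => j [] fi i i'; rewrite !ffunE /= => /fi /addrI //.
exact: oppr_inj.
Qed.

Lemma cycle_edges_dihedral f u : cycle_edges (dihedral f u) = cycle_edges f.
Proof.
case: u => j []; apply/setP => S; apply/cycle_edgesP/cycle_edgesP => -[i ->];
  rewrite ?ffunE /=.
- by exists (j + i); rewrite addrA.
- by exists (i - j); rewrite !ffunE /=; congr [set f _; f _]; ring.
- by exists (j - i - 1); rewrite finset.setUC; congr [set f _; f _]; ring.
- by exists (j - i - 1); rewrite !ffunE /= finset.setUC; congr [set f _; f _]; ring.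
Qed.

(** At least this many by the dihedral images of [f]. At most this many because [g] is determined by
    [(g 0, g 1)], an edge of [f] in one of its two orientations. *)
Lemma card_cycle_fiber f : injective f ->
  #|[set g : {ffun 'I_m.+3 -> 'I_n} |
      injectiveb g && (cycle_edges g == cycle_edges f)]| = (2 * m.+3)%N.
Proof.
move=> fi; apply/eqP; rewrite eqn_leq; apply/andP; split; last first.
  have -> : (2 * m.+3 = #|dihedral f @: [set: 'I_m.+3 * bool]|)%N.
    rewrite card_imset; last exact: dihedral_inj.
    by rewrite cardsT card_prod card_ord card_bool mulnC.
  apply/subset_leq_card/subsetP => _ /imsetP[u _ ->].
  by rewrite inE cycle_edges_dihedral eqxx andbT; apply/injectiveP/injective_dihedral.
set G := [set g | _].
have hG (g : {ffun 'I_m.+3 -> 'I_n}) : g \in G ->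
    injective g /\ cycle_edges g = cycle_edges f.
  by rewrite inE => /andP[/injectiveP gi /eqP].
rewrite -(card_in_imset (f := fun g : {ffun 'I_m.+3 -> 'I_n} => (g 0, g 1))); last first.
  move=> g g' /hG[gi gf] /hG[gi' gf'] [e0 e1].
  by apply: eq_cycle_map => //; rewrite gf.
pose Y1 := [set (f i, f (i + 1)) | i : 'I_m.+3].
pose Y2 := [set (f (i + 1), f i) | i : 'I_m.+3].
apply: (@leq_trans #|Y1 :|: Y2|).
  apply/subset_leq_card/subsetP => _ /imsetP[g /hG[gi gf] ->].
  have := mem_cycle_edges g 0; rewrite gf add0r => /cycle_edgesP[i].
  by case/eq_set2 => -[-> ->]; rewrite inE; apply/orP; [left|right]; apply/imsetP; exists i.
apply: leq_trans (leq_card_setU _ _) _; rewrite mul2n -addnn.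
by apply: leq_add; apply: leq_trans (leq_imset_card _ _) _; rewrite card_ord.
Qed.

End CardCycleMaps.

Lemma card_cycle_maps m n (E : {set {set 'I_n}}) : 3 <= m ->
  #|cycle_maps m E| = 2 * m * num_cycles m E.
Proof.
case: m => [|[|[|m]]] // _.
rewrite num_cyclesE -sum1_card (partition_big_imset (@cycle_edges m.+3 n)) /=.
rewrite mulnC -sum_nat_const; apply: eq_bigr => S /imsetP[f].
rewrite inE => /andP[/injectiveP fi fE ->]; rewrite -(card_cycle_fiber fi).
rewrite -sum1_card; apply: eq_bigl => g; rewrite !inE -andbA.
have [->|_] := eqVneq (cycle_edges g) (cycle_edges f); last by rewrite !andbF.
by rewrite fE.
Qed.

(** * Upper bound: walks and cycles in graphs without a given odd cycle *)

Section Adjacency.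
Variables (n : nat) (E : {set {set 'I_n}}).

Definition adj : rel 'I_n := fun x y => [set x; y] \in E.

Lemma adj_sym : symmetric adj.
Proof. by move=> x y; rewrite /adj finset.setUC. Qed.

Lemma adj_irr : simple_graph E -> irreflexive adj.
Proof.
move=> /forall_inP sE x; apply: contraTF isT => /sE.
by rewrite finset.setUid cards1.
Qed.

Lemma cycle_mapsP m (f : {ffun 'I_m -> 'I_n}) :
  reflect (injective f /\ forall i, adj (f i) (f (ordS i))) (f \in cycle_maps m E).
Proof.
rewrite inE; apply: (iffP andP) => [[/injectiveP fi /subsetP fE]|[fi fE]]; split=> //.
- by move=> i; apply/fE/imset_f.
- exact/injectiveP.
- by apply/subsetP => _ /imsetP[i _ ->]; apply: fE.
Qed.

(** Forgetting the closing edge and injectivity turns a cyclic map on [m.+1] vertices into a walk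
    with [m] edges. *)
Lemma card_cycle_maps_walks m :
  #|cycle_maps m.+1 E| <= \sum_x size (walks adj m x).
Proof.
pose L := [seq x :: p | x <- enum 'I_n, p <- walks adj m x].
have -> : \sum_x size (walks adj m x) = size L.
  by rewrite size_allpairs_dep sumnE big_map big_enum.
pose s (f : {ffun 'I_m.+1 -> 'I_n}) := [seq f (inord i) | i <- iota 0 m.+1].
have s_inj : injective s.
  move=> f g fg; apply/ffunP => i.
  have := congr1 (fun t => nth (f i) t i) fg.
  by rewrite !(nth_map 0) ?size_iota // nth_iota // add0n inord_val.
rewrite cardE -(size_map s); apply: uniq_leq_size.
  by rewrite map_inj_uniq // enum_uniq.
move=> _ /mapP[f + ->]; rewrite mem_enum => /cycle_mapsP[_ fE].
apply/allpairsPdep; exists (f (inord 0)), [seq f (inord i) | i <- iota 1 m].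
split; rewrite ?mem_enum // mem_walks size_map size_iota eqxx /=.
apply/(pathP (f (inord 0))) => i; rewrite size_map size_iota => im.
have -> : f (inord 0) :: [seq f (inord i) | i <- iota 1 m] = s f by [].
rewrite !(nth_map 0) ?size_iota //; last by apply: ltnW.
rewrite !nth_iota //; last by apply: ltnW.
suff -> : inord (1 + i) = ordS (inord i : 'I_m.+1) by apply: fE.
by apply: val_inj; rewrite /= !inordK ?modn_small // ltnW.
Qed.

Lemma cycle_maps_seq (x : 'I_n) (s : seq 'I_n) :
  uniq (x :: s) -> cycle adj (x :: s) -> cycle_maps (size s).+1 E != set0.
Proof.
move=> us /(pathP x) cs; apply/set0Pn.
exists [ffun i : 'I_(size s).+1 => nth x (x :: s) i]; apply/cycle_mapsP; split.
  by move=> i j; rewrite !ffunE => /eqP; rewrite nth_uniq // => /eqP /val_inj.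
move=> i; rewrite !ffunE; have := cs i; rewrite size_rcons => /(_ (ltn_ord i)).
have := ltn_ord i; rewrite -rcons_cons !nth_rcons /= => il.
rewrite il; move: il; rewrite ltnS leq_eqVlt => /orP[/eqP ->|il].
  (* At the last index the [x] appended by [cycle] agrees with the wrap-around of [ordS]. *)
  by rewrite ltnn eqxx modnn.
by rewrite il modn_small.
Qed.

(** A path on [2 * k] vertices among the neighbours of [y] would close up through [y] to a cycle on
    [2 * k + 1] vertices. Hence [sparse_or_path] is used with [(2 * k).-1], one less than the number
    of vertices. *)
Lemma odd_cycle_free_sparse_nbhd (k : nat) (y : 'I_n) :
    0 < k -> simple_graph E -> cycle_free (2 * k + 1) E ->
  #|[set u : 'I_n * 'I_n | [&& adj u.1 u.2, adj y u.1 & adj y u.2]]| <= 4 * k * n.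
Proof.
move=> k0 sE; rewrite cycle_freeE => /eqP cE.
have [|hle] := sparse_or_path adj_sym (adj_irr sE) (2 * k).-1 [set x | adj y x].
  case=> -[|x s] [//= ss us ps sA].
  have hA z : z \in x :: s -> adj y z by move=> /sA; rewrite inE.
  have ys : y \notin x :: s by apply/negP => /hA; rewrite adj_irr.
  have /negP[] : cycle_maps (size (x :: s)).+1 E != set0.
    apply: (@cycle_maps_seq y); first by rewrite cons_uniq ys.
    by rewrite /= rcons_path ps hA ?mem_head // adj_sym hA // mem_last.
  by rewrite /= ss prednK ?muln_gt0 // -addn1 cE.
have hn : #|[set x | adj y x]| <= n by rewrite -[leqRHS]card_ord max_card.
apply: (@leq_trans (2 * (2 * k).-1 * #|[set x | adj y x]|)); last first.
  by apply: leq_mul => //; lia.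
by move: hle; congr (_ <= _); apply: eq_card => u; rewrite !inE.
Qed.

Lemma size_walks2_bound (k : nat) (y : 'I_n) :
    0 < k -> simple_graph E -> cycle_free (2 * k + 1) E ->
  2 * size (walks adj 2 y) <= #|[set u : 'I_n * 'I_n | adj u.1 u.2]| + 4 * k * n.
Proof.
move=> k0 sE cE; apply: leq_trans (double_size_walks2 adj_sym y) _.
by rewrite leq_add2l; apply: odd_cycle_free_sparse_nbhd.
Qed.

Lemma odd_cycle_free_edges (k : nat) :
    0 < k -> simple_graph E -> cycle_free (2 * k + 1) E ->
  2 * #|[set u : 'I_n * 'I_n | adj u.1 u.2]| <= n ^ 2 + 8 * k * n.
Proof.
move=> k0 sE cE; set M := #|_|.
have hM : 2 * M ^ 2 <= n * (n * (M + 4 * k * n)).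
  rewrite /M -sum_size_walks1.
  have := leq_sqr_sum (fun x => size (walks adj 1 x)).
  rewrite card_ord -(leq_pmul2l (isT : 0 < 2)) => /leq_trans; apply.
  rewrite mulnCA leq_mul2l -(sum_size_walks2 adj_sym) big_distrr /=.
  rewrite -[X in X * (_ + _)]card_ord -sum_nat_const; apply/orP; right.
  apply: leq_sum => y _; rewrite sum_size_walks1; exact: size_walks2_bound.
(* If [2 * M > n ^ 2 + 8 * k * n], then [2 * M ^ 2] exceeds [n ^ 2 * M + 8 * k * n * M], where the
   last term is at least [4 * k * n ^ 3]; this contradicts [hM]. *)
rewrite leqNgt; apply/negP => hlt; nia.
Qed.

Lemma num_even_cycles_bound (k l : nat) :
    0 < k -> 1 < l -> simple_graph E -> cycle_free (2 * k + 1) E ->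
  4 ^ l * (2 * l * num_cycles (2 * l) E) <= (n ^ 2 + 16 * k * n) ^ l.
Proof.
move=> k0 l1 sE cE; set D := n ^ 2 + _.
have hM := odd_cycle_free_edges k0 sE cE; set M := #|_| in hM.
(* Doubling [size_walks2_bound] gives [2 * M + 8 * k * n], and [hM] adds another [8 * k * n]: hence
   the 16 in [D]. *)
have hD y : 4 * size (walks adj 2 y) <= D.
  by have := size_walks2_bound y k0 sE cE; rewrite -/M; rewrite /D; lia.
have hc := @card_cycle_maps (2 * l) n E.
have {}hc : 2 * (2 * l) * num_cycles (2 * l) E <=
    \sum_x size (walks adj (2 * l).-1 x).
  rewrite -hc; last lia.
  have : 0 < 2 * l by lia.
  by case: (2 * l) => [//|m] _; apply: card_cycle_maps_walks.
(* A walk with [(2 * l).-1] edges is one ordered edge, with [M] choices, followed by [l.-1] walks of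
   length 2. The remaining factor of [D] comes from [2 * M <= D]. *)
have {}hc : 4 ^ l.-1 * (2 * (2 * l) * num_cycles (2 * l) E) <= M * D ^ l.-1.
  apply: (leq_trans (leq_mul (leqnn _) hc)).
  have -> : (2 * l).-1 = (2 * l.-1).+1 by lia.
  rewrite /M -sum_size_walks1 big_distrr big_distrl /=; apply: leq_sum => x _.
  rewrite size_walksS size_walks1 big_distrr big_distrl /=; apply: leq_sum => y _.
  by rewrite mul1n; apply: size_walks_even.
have -> : l = l.-1.+1 by lia.
rewrite !expnS /=; have -> : l.-1.+1 = l by lia.
have : 2 * (M * D ^ l.-1) <= D * D ^ l.-1.
  by rewrite mulnA leq_mul2r; apply/orP; right; rewrite /D; lia.
nia.
Qed.

End Adjacency.

(** * Lower bound: cycles in the balanced bipartite graph *)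

(** Each successor flips the colour, so [j%:R] has the colour of 0 flipped [j] times. One full turn,
    [j = m.+2], is back at 0 and must therefore be even. *)
Lemma alternating_ord m (c : 'I_m.+2 -> bool) :
  (forall i, c i != c (ordS i)) -> ~~ odd m.
Proof.
move=> hc; suff h j : c j%:R%R = odd j (+) c 0%R.
  have := h m.+2; rewrite (pchar_Zp (isT : 1 < m.+2)) /=.
  by rewrite negbK; case: (odd m); case: (c 0%R).
elim: j => [|j IHj]; first by rewrite GRing.mulr0n.
have := hc j%:R%R; rewrite ordS_add1 GRing.natr1 IHj /=.
by case: (odd j); case: (c _); case: (c _).
Qed.

Section ParityGraph.
Variable n : nat.

Definition parity_graph : {set {set 'I_n}} :=
  [set [set u.1; u.2] | u in [set u : 'I_n * 'I_n | odd u.1 && ~~ odd u.2]].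

Lemma adj_parity x y : adj parity_graph x y = (odd x != odd y).
Proof.
apply/imsetP/idP => [[[a b]]|].
  by rewrite inE /= => /andP[oa ob] /eq_set2[] [-> ->]; rewrite oa (negbTE ob).
move=> oxy; case ox: (odd x) oxy => oxy.
  by exists (x, y); rewrite // inE /= ox; case: (odd y) oxy.
by exists (y, x); rewrite ?inE /= ?ox ?andbT; [case: (odd y) oxy | rewrite finset.setUC].
Qed.

Lemma simple_parity_graph : simple_graph parity_graph.
Proof.
apply/forall_inP => _ /imsetP[[a b] + ->]; rewrite inE /= => /andP[oa ob].
rewrite cards2; suff -> : a != b by [].
by apply: contraNneq ob => <-.
Qed.

Lemma parity_graph_cycle_free k : 0 < k -> cycle_free (2 * k + 1) parity_graph.
Proof.
move=> k0; rewrite cycle_freeE; apply/eqP/setP => f; rewrite in_set0.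
apply/negP => /cycle_mapsP[_ fE]; move: f fE.
have -> : 2 * k + 1 = (2 * k.-1).+1.+2 by lia.
move=> f fE.
have : forall i, odd (f i) != odd (f (ordS i)) by move=> i; rewrite -adj_parity.
by move/(@alternating_ord _ (fun i => odd (f i))); rewrite /= oddM.
Qed.

Fact lt_vertex (x : 'I_n./2) (c : bool) : x.*2 + c < n.
Proof. by have := ltn_ord x; lia. Qed.

(** Indexes the two parity classes by the same type; for odd [n] this leaves out the vertex
    [n - 1]. *)
Definition vertex (x : 'I_n./2) (c : bool) : 'I_n := Ordinal (lt_vertex x c).

Fact lt_half_ord l (i : 'I_(2 * l)) : i./2 < l.
Proof. by have := ltn_ord i; lia. Qed.

Definition half_ord l (i : 'I_(2 * l)) : 'I_l := Ordinal (lt_half_ord i).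

(** [u.1.1] chooses the vertices at even positions, [u.1.2] those at odd positions, and [u.2] is the
    parity of the vertex at position 0. *)
Definition alternating_map l
    (u : {ffun 'I_l -> 'I_n./2} * {ffun 'I_l -> 'I_n./2} * bool) :
    {ffun 'I_(2 * l) -> 'I_n} :=
  [ffun i : 'I_(2 * l) =>
     vertex ((if odd i then u.1.2 else u.1.1) (half_ord i)) (odd i (+) u.2)].

Lemma alternating_map_inj l : 0 < l -> injective (@alternating_map l).
Proof.
move=> l0 [[a b] c] [[a' b'] c'] /ffunP h.
have hd (d : bool) (j : 'I_l) : d + 2 * j < 2 * l by have := ltn_ord j; lia.
have hj (d : bool) (j : 'I_l) : half_ord (Ordinal (hd d j)) = j.
  by apply: val_inj => /=; case: d; lia.
have {h} h d j : vertex ((if d then b else a) j) (d (+) c) =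
                 vertex ((if d then b' else a') j) (d (+) c').
  have := h (Ordinal (hd d j)); rewrite !ffunE /= hj.
  by rewrite oddD oddM addbF oddb.
have vinj x y d d' : vertex x d = vertex y d' -> x = y /\ d = d'.
  move=> /(congr1 val) /= e; split; last first.
    by have := congr1 odd e; rewrite !oddD !odd_double !oddb.
  by apply: val_inj; move: e; case: d; case: d' => /=; lia.
have [_ /= <-] := vinj _ _ _ _ (h false (Ordinal l0)).
congr (_, _, _); apply/ffunP => j.
  by have [] := vinj _ _ _ _ (h false j).
by have [] := vinj _ _ _ _ (h true j).
Qed.

Lemma alternating_map_cycle l
    (u : {ffun 'I_l -> 'I_n./2} * {ffun 'I_l -> 'I_n./2} * bool) :
    injective u.1.1 -> injective u.1.2 ->
  alternating_map u \in cycle_maps (2 * l) parity_graph.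
Proof.
move: u => [[a b] c] /= ai bi; apply/cycle_mapsP; split=> [i j|i]; last first.
  rewrite adj_parity !ffunE /= !oddD !odd_double !oddb.
  have -> : odd (i.+1 %% (2 * l)) = ~~ odd i.
    by rewrite -[RHS]/(odd i.+1) {2}(divn_eq i.+1 (2 * l)) oddD !oddM andbF.
  by case: (odd i); case: c.
rewrite !ffunE /= => /(congr1 val) /= e.
have oij : odd i = odd j.
  by have := congr1 odd e; rewrite !oddD !odd_double !oddb !addFb => /addIb.
have hij : half_ord i = half_ord j.
  rewrite oij in e; move: e => /addIn /double_inj /val_inj.
  by case: ifP => _; [apply: bi | apply: ai].
apply: val_inj; rewrite /= -[LHS]odd_double_half -[RHS]odd_double_half oij.
by have := congr1 val hij => /= ->.
Qed.

Lemma parity_graph_num_cycles l : 1 < l ->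
  (n - (2 * l + 1)) ^ (2 * l) <= 4 ^ l * (2 * l * num_cycles (2 * l) parity_graph).
Proof.
move=> l1; have l0 := ltnW l1.
pose I := [set f : {ffun 'I_l -> 'I_n./2} | injectiveb f].
have cI : (n./2 - l) ^ l <= #|I|.
  rewrite card_inj_ffuns !card_ord ffact_prod -[X in _ ^ X]card_ord -prod_nat_const.
  (* Each factor [n./2 - i] of the falling factorial is at least [n./2 - l]. *)
  by apply: leq_prod => i _; have := ltn_ord i; lia.
have : #|setX (setX I I) [set: bool]| <= #|cycle_maps (2 * l) parity_graph|.
  rewrite -(card_imset _ (alternating_map_inj l0)); apply/subset_leq_card/subsetP.
  move=> _ /imsetP[[[a b] c] uI ->]; apply: alternating_map_cycle; move: uI;
    by rewrite !in_setX !inE andbT => /andP[/injectiveP ai /injectiveP bi].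
rewrite !cardsX cardsT card_bool card_cycle_maps; last by lia.
move=> h.
(* The two choices of starting parity cancel the 2 in [card_cycle_maps]. *)
have {h} h : (n./2 - l) ^ (2 * l) <= 2 * l * num_cycles (2 * l) parity_graph.
  rewrite mul2n -addnn expnD -(leq_pmul2r (isT : 0 < 2)) addnn -mul2n.
  apply: leq_trans (leq_mul (leq_mul cI cI) (leqnn 2)) (leq_trans h _).
  by rewrite -mulnA mulnC.
apply: (leq_trans _ (leq_mul (leqnn (4 ^ l)) h)).
(* Reduces to [n - (2 * l + 1) <= 2 * (n./2 - l)]; the extra 1 pays for rounding when [n] is odd. *)
rewrite -[4]/(2 ^ 2) -expnM -expnMn leq_exp2r; lia.
Qed.

End ParityGraph.

(** * Two-sided bound and passage to the limit *)

Lemma ex_even_cycles_bounds (k l n : nat) : 0 < k -> 1 < l ->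
  (n - (2 * l + 1)) ^ (2 * l) <= 4 ^ l * (2 * l * ex_cycles n (2 * l) (2 * k + 1))
    <= (n ^ 2 + 16 * k * n) ^ l.
Proof.
move=> k0 l1; apply/andP; split.
  apply: leq_trans (parity_graph_num_cycles n l1) _.
  rewrite !leq_mul2l; apply/orP; right; apply/orP; right.
  apply: leq_bigmax_cond.
  by rewrite simple_parity_graph parity_graph_cycle_free.
rewrite /ex_cycles; elim/big_ind: _ => [|x y hx hy|E /andP[sE cE]].
- by rewrite !muln0.
- by rewrite /maxn; case: ifP.
- exact: num_even_cycles_bound.
Qed.

Local Open Scope classical_set_scope.
Local Open Scope ring_scope.

Lemma cvg_affine_inv_pow (R : realType) (c : R) (p : nat) :
  (fun n : nat => (1 + c / n%:R) ^+ p) @ \oo --> (1 : R).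
Proof.
have h : (fun n : nat => c / n%:R) @ \oo --> (0 : R).
  rewrite -(mulr0 c); apply: cvgMr; apply/gtr0_cvgV0.
    by near=> n; rewrite ltr0n; near: n; exists 1%N.
  exact: cvgr_idn.
have h1 : (fun n : nat => 1 + c / n%:R) @ \oo --> (1 : R).
  by have := cvgD (cvg_cst (1 : R)) h; rewrite addr0; apply.
elim: p => [|p IHp].
  by under eq_fun do rewrite expr0; apply: cvg_cst.
under eq_fun do rewrite exprS.
by have := cvgM h1 IHp; rewrite mulr1; apply.
Unshelve. all: by end_near.
Qed.

(* ex(n, C_{2l}, C_{2k+1}) / ( (1/(2l)) (n^2/4)^l ) --> 1 as n --> oo *)
Theorem theorem20 (R : realType) (k l : nat) (hk : (1 <= k)%N) (hl : (2 <= l)%N) :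
  (fun n : nat =>
     (ex_cycles n (2 * l) (2 * k + 1))%:R
       / ((2 * l)%:R^-1 * ((n%:R : R) ^+ 2 / 4) ^+ l))
  @ \oo --> (1 : R).
Proof.
(* [lo] and [hi] are the bounds of [ex_even_cycles_bounds] divided by [n ^ (2 * l)]. *)
pose lo n : R := (1 + - (2 * l + 1)%:R / n%:R) ^+ (2 * l).
pose hi n : R := (1 + (16 * k)%:R / n%:R) ^+ l.
apply: (@squeeze_cvgr _ _ _ _ lo hi); [|exact: cvg_affine_inv_pow..].
(* From here on the natural subtraction in the lower bound is not truncated, and [n] is nonzero. *)
near=> n; have ln : (2 * l + 1 <= n)%N by near: n; exists (2 * l + 1)%N.
have n0 : (n%:R : R) != 0 by rewrite pnatr_eq0; lia.
have p0 : (0 : R) < n%:R ^+ 2 ^+ l by rewrite !exprn_gt0 // ltr0n; lia.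
set ex := ex_cycles _ _ _.
have -> : ex%:R / ((2 * l)%:R^-1 * ((n%:R : R) ^+ 2 / 4) ^+ l)
        = (4 ^ l * (2 * l * ex))%N%:R / (n%:R ^+ 2 ^+ l).
  rewrite expr_div_n !natrM natrX; field.
  by rewrite lt0r_neq0 // expf_neq0 //= pnatr_eq0; lia.
have /andP[] := ex_even_cycles_bounds n hk hl; rewrite -/ex.
rewrite -(ler_nat R) => lb; rewrite -(ler_nat R) => ub; apply/andP; split.
  rewrite ler_pdivlMr // (le_trans _ lb) // natrX natrB // /lo -exprM -exprMn.
  by rewrite mulrDl mul1r divfK.
rewrite ler_pdivrMr // (le_trans ub) // natrX /hi -exprMn natrD natrX natrM.
rewrite le_eqVlt; apply/orP; left; apply/eqP; congr (_ ^+ _); field.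
Unshelve. all: by end_near.
Qed.
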